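(* Let $K$ be a $\mathfrak{g}$-field. Then $[K:K^{\mathfrak{g}}]\leqslant e$.
   Context: Let $\mathbf{k}$ be a field and $\mathfrak{g}=\mathrm{Spec}(H)$ a finite group scheme over $\mathbf{k}$, with $H$ a finite-dimensional commutative Hopf algebra (comultiplication $\mu$, counit $\pi$), and $e=\dim_{\mathbf{k}}H$ (the order of $\mathfrak{g}$). A $\mathfrak{g}$-field is a field $K\supseteq\mathbf{k}$ with a $\mathbf{k}$-algebra map $\partial:K\to K\otimes_{\mathbf{k}}H$ satisfying $(\mathrm{id}\otimes\pi)\circ\partial=\mathrm{id}$ and $(\mathrm{id}\otimes\mu)\circ\partial=(\partial\otimes\mathrm{id})\circ\partial$ (an action of $\mathfrak{g}$ on $\mathrm{Spec}(K)$). The field of constants is $K^{\mathfrak{g}}=\{x\in K:\partial(x)=x\otimes 1\}$. *)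

(* Defs.v *)
From HB Require Import structures.
From mathcomp Require Import all_boot all_order all_algebra all_field.

Set Implicit Arguments.
Unset Strict Implicit.
Unset Printing Implicit Defensive.

Import GRing.Theory.
Local Open Scope ring_scope.

(* V (x) W for an arbitrary k-module V and a finite-dimensional W: families of *)
(* elements of V indexed by a basis (e_i) of W, (v_i)_i standing for           *)
(* \sum_i v_i (x) e_i. The lemmas tlift_tens, tlift_unique (and linear_tlift)  *)
(* state the universal property, so the choice of basis is immaterial.         *)
Definition tensor (k : fieldType) (V : lmodType k) (W : vectType k) : Type :=
  {ffun 'I_(\dim {:W}) -> V}.

Section TensorModule.
Variables (k : fieldType) (V : lmodType k) (W : vectType k).

HB.instance Definition _ := GRing.Lmodule.copy (tensor V W)
  {ffun 'I_(\dim {:W}) -> V}.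

Definition tbasis (i : 'I_(\dim {:W})) : W := (vbasis {:W})`_i.

Definition tcoord (t : tensor V W) (i : 'I_(\dim {:W})) : V :=
  (t : {ffun 'I_(\dim {:W}) -> V}) i.

Definition tens (v : V) (w : W) : tensor V W :=
  [ffun i => coord (vbasis {:W}) i w *: v].

(* The map V (x) W -> U induced by a bilinear f : V -> W -> U. *)
Definition tlift (U : zmodType) (f : V -> W -> U) (t : tensor V W) : U :=
  \sum_i f (tcoord t i) (tbasis i).

End TensorModule.

HB.instance Definition _ (k : fieldType) (V W : vectType k) :=
  Vector.copy (tensor V W) {ffun 'I_(\dim {:W}) -> V}.

Notation "v \ox w" := (tens v w) (at level 40, left associativity) : ring_scope.

Section TensorTheory.
Variables (k : fieldType) (V : lmodType k) (W : vectType k).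
Implicit Types (t : tensor V W) (v : V) (w : W).

Lemma tensorP t u : (forall i, tcoord t i = tcoord u i) -> t = u.
Proof. by move=> e; apply/ffunP. Qed.

Lemma tcoordE v w i : tcoord (v \ox w) i = coord (vbasis {:W}) i w *: v.
Proof. exact: ffunE. Qed.

Lemma tcoordD t u i : tcoord (t + u) i = tcoord t i + tcoord u i.
Proof. exact: ffunE. Qed.

Lemma tcoordZ c t i : tcoord (c *: t) i = c *: tcoord t i.
Proof. exact: ffunE. Qed.

Lemma tcoord_sum (I : finType) (F : I -> tensor V W) i :
  tcoord (\sum_j F j) i = \sum_j tcoord (F j) i.
Proof. exact: sum_ffunE. Qed.

Lemma coord_tbasis i j :
  coord (vbasis {:W}) j (tbasis i) = (i == j)%:R.
Proof. by rewrite /tbasis coord_free ?(basis_free (vbasisP _)) // eq_sym. Qed.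

Lemma tens_linearl w : linear (fun v => v \ox w).
Proof.
move=> c u v; apply: tensorP => i.
by rewrite tcoordD tcoordZ !tcoordE scalerDr !scalerA mulrC.
Qed.

Lemma tens_linearr v : linear (fun w => v \ox w).
Proof.
move=> c u w; apply: tensorP => i.
by rewrite tcoordD tcoordZ !tcoordE linearP scalerDl scalerA.
Qed.

Lemma tensZl c v w : (c *: v) \ox w = c *: (v \ox w).
Proof. by apply: tensorP => i; rewrite tcoordZ !tcoordE !scalerA mulrC. Qed.

Lemma tensZr c v w : v \ox (c *: w) = c *: (v \ox w).
Proof. by apply: tensorP => i; rewrite tcoordZ !tcoordE linearZ scalerA. Qed.

Lemma tensor_sum t : t = \sum_i tcoord t i \ox tbasis i.
Proof.
apply: tensorP => j; rewrite tcoord_sum (bigD1 j) //= tcoordE coord_tbasis eqxx.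
rewrite scale1r big1 ?addr0 // => i /negPf nij.
by rewrite tcoordE coord_tbasis nij scale0r.
Qed.

Section Lift.
Variables (U : lmodType k) (f : V -> W -> U).
Hypotheses (fl : forall w, linear (f^~ w)) (fr : forall v, linear (f v)).

Lemma tlift_tens v w : tlift f (v \ox w) = f v w.
Proof.
have fZl c u y : f (c *: u) y = c *: f u y.
  have f0 : f 0 y = 0 by have := fl y (-1) 0 0; rewrite scaler0 addr0 scaleN1r addNr.
  by have := fl y c u 0; rewrite !addr0 /= f0 addr0.
pose g : {linear W -> U} := HB.pack (f v) (GRing.isLinear.Build k W U _ (f v) (fr v)).
transitivity (g w); last by [].
rewrite [in RHS](coord_vbasis (memvf w)) linear_sum /tlift; apply: eq_bigr => i _.
by rewrite tcoordE fZl linearZ.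
Qed.

Lemma linear_tlift : linear (tlift f).
Proof.
move=> c t u; rewrite /tlift scaler_sumr -big_split; apply: eq_bigr => i _ /=.
by rewrite tcoordD tcoordZ; apply: fl.
Qed.

Lemma tlift_unique (g : {linear tensor V W -> U}) :
  (forall v w, g (v \ox w) = f v w) -> g =1 tlift f.
Proof.
move=> gE t; rewrite [in LHS](tensor_sum t) linear_sum.
by apply: eq_bigr => i _; rewrite gE.
Qed.

End Lift.

End TensorTheory.

Section TensorMaps.
Variable k : fieldType.

Definition tmap (V V' : lmodType k) (W W' : vectType k)
    (f : V -> V') (g : W -> W') : tensor V W -> tensor V' W' :=
  tlift (fun v w => f v \ox g w).

Definition tassoc (V : lmodType k) (W X : vectType k) :
    tensor (tensor V W) X -> tensor V (tensor W X) :=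
  tlift (fun t x => tlift (fun v w => v \ox (w \ox x)) t).

Definition tunitl (W : vectType k) : tensor k^o W -> W :=
  tlift (fun (c : k^o) w => (c : k) *: w).

Definition tunitr (V : lmodType k) : tensor V k^o -> V :=
  tlift (fun v (c : k^o) => (c : k) *: v).

Definition tmult (A : falgType k) : tensor A A -> A :=
  tlift (fun a b : A => a * b).

End TensorMaps.

Section TensorAlgebra.
Variables (k : fieldType) (A : algType k) (B : falgType k).
Implicit Types (t u v : tensor A B).

Definition tone : tensor A B := 1 \ox 1.

Definition tmul t u : tensor A B :=
  tlift (fun a x => tlift (fun b y => (a * b) \ox (x * y)) u) t.

Let tDl (x : B) (a b : A) : (a + b) \ox x = a \ox x + b \ox x.
Proof. by have := tens_linearl x 1 a b; rewrite !scale1r. Qed.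

Let tDr (a : A) (x y : B) : a \ox (x + y) = a \ox x + a \ox y.
Proof. by have := tens_linearr a 1 x y; rewrite !scale1r. Qed.

Let mulAl (b : A) (x y : B) :
  linear (fun a : A => (a * b) \ox (x * y)).
Proof. by move=> c a a'; rewrite mulrDl -scalerAl; apply: tens_linearl. Qed.

Let mulAr (a : A) (x y : B) :
  linear (fun b : A => (a * b) \ox (x * y)).
Proof. by move=> c b b'; rewrite mulrDr -scalerAr; apply: tens_linearl. Qed.

Let mulBl (a b : A) (y : B) :
  linear (fun x : B => (a * b) \ox (x * y)).
Proof. by move=> c a' b'; rewrite mulrDl -scalerAl; apply: tens_linearr. Qed.

Let mulBr (a b : A) (x : B) :
  linear (fun y : B => (a * b) \ox (x * y)).
Proof. by move=> c a' b'; rewrite mulrDr -scalerAr; apply: tens_linearr. Qed.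

Let mul_linl u x : linear (fun a : A => tlift (fun b y => (a * b) \ox (x * y)) u).
Proof.
move=> c a b; rewrite /tlift scaler_sumr -big_split; apply: eq_bigr => i _.
exact: mulAl.
Qed.

Let mul_linr u a : linear (fun x : B => tlift (fun b y => (a * b) \ox (x * y)) u).
Proof.
move=> c x y; rewrite /tlift scaler_sumr -big_split; apply: eq_bigr => i _.
exact: mulBl.
Qed.

Lemma tmul_tens (a b : A) (x y : B) :
  tmul (a \ox x) (b \ox y) = (a * b) \ox (x * y).
Proof.
rewrite /tmul (tlift_tens (mul_linl _) (mul_linr _)).
by rewrite (tlift_tens (fun y => mulAr _ _ y) (fun b => mulBr _ b _)).
Qed.

Let tmul_linl u : linear (tmul^~ u).
Proof. exact: (linear_tlift (mul_linl u)). Qed.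

Let tmul_linr t : linear (tmul t).
Proof.
move=> c u v; rewrite /tmul /tlift scaler_sumr -big_split; apply: eq_bigr => i _.
exact: (linear_tlift (fun y => mulAr _ _ y)).
Qed.

Let tmulDl : left_distributive tmul +%R.
Proof. by move=> t u v; have := tmul_linl v 1 t u; rewrite !scale1r. Qed.

Let tmulDr : right_distributive tmul +%R.
Proof. by move=> t u v; have := tmul_linr t 1 u v; rewrite !scale1r. Qed.

Let tmul0l t : tmul 0 t = 0.
Proof. by apply: (addIr (tmul 0 t)); rewrite -tmulDl !add0r. Qed.

Let tmul0r t : tmul t 0 = 0.
Proof. by apply: (addIr (tmul t 0)); rewrite -tmulDr !add0r. Qed.

Lemma tensor_ind (P : tensor A B -> Prop) :
  P 0 -> (forall t u, P t -> P u -> P (t + u)) -> (forall a x, P (a \ox x)) ->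
  forall t, P t.
Proof. by move=> P0 PD Pt t; rewrite (tensor_sum t); apply: big_ind. Qed.

Let tmulA : associative tmul.
Proof.
move=> t u v; elim/tensor_ind: t => [|t t' Ht Ht'|a x].
- by rewrite !tmul0l.
- by rewrite !tmulDl Ht Ht'.
elim/tensor_ind: u => [|u u' Hu Hu'|b y].
- by rewrite !(tmul0l, tmul0r).
- by rewrite !(tmulDl, tmulDr) Hu Hu'.
elim/tensor_ind: v => [|v v' Hv Hv'|c z].
- by rewrite !tmul0r.
- by rewrite !tmulDr Hv Hv'.
by rewrite !tmul_tens !mulrA.
Qed.

Let tmul1l : left_id tone tmul.
Proof.
elim/tensor_ind=> [|t u Ht Hu|a x]; first exact: tmul0r.
  by rewrite tmulDr Ht Hu.
by rewrite tmul_tens !mul1r.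
Qed.

Let tmul1r : right_id tone tmul.
Proof.
elim/tensor_ind=> [|t u Ht Hu|a x]; first exact: tmul0l.
  by rewrite tmulDl Ht Hu.
by rewrite tmul_tens !mulr1.
Qed.

Let tone_neq0 : tone != 0.
Proof.
apply/eqP => t0; have /eqP[] := oner_neq0 B.
rewrite (coord_vbasis (memvf (1 : B))); apply: big1 => i _.
suff -> : coord (vbasis {:B}) i 1 = 0 by rewrite scale0r.
have /eqP : tcoord tone i = 0 by rewrite t0; apply: ffunE.
by rewrite tcoordE scaler_eq0 oner_eq0 orbF => /eqP.
Qed.

HB.instance Definition _ := GRing.Zmodule_isNzRing.Build (tensor A B)
  tmulA tmul1l tmul1r tmulDl tmulDr tone_neq0.

Let tscaleAl (c : k) t u : c *: (t * u) = (c *: t) * u.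
Proof.
have := tmul_linl u c t 0; rewrite !addr0 tmul0l addr0.
by move=> e; rewrite -[LHS]e.
Qed.

Let tscaleAr (c : k) t u : c *: (t * u) = t * (c *: u).
Proof.
have := tmul_linr t c u 0; rewrite !addr0 tmul0r addr0.
by move=> e; rewrite -[LHS]e.
Qed.

HB.instance Definition _ := GRing.Lmodule_isLalgebra.Build k (tensor A B) tscaleAl.
HB.instance Definition _ := GRing.Lalgebra_isAlgebra.Build k (tensor A B) tscaleAr.

Lemma tensM (a b : A) (x y : B) : (a \ox x) * (b \ox y) = (a * b) \ox (x * y).
Proof. exact: tmul_tens. Qed.

Lemma tens11 : 1 \ox 1 = 1 :> tensor A B.
Proof. by []. Qed.

End TensorAlgebra.

(* A finite group scheme Spec H over k is given by its coordinate ring H, a    *)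
(* finite-dimensional commutative Hopf algebra.                                *)
Record finGroupScheme (k : fieldType) := FinGroupScheme {
  coord_ring :> falgType k;
  coord_ringC : commutative (@GRing.mul coord_ring);
  comul : {lrmorphism coord_ring -> tensor coord_ring coord_ring};
  counit : {lrmorphism coord_ring -> k^o};
  antipode : {linear coord_ring -> coord_ring};
  comulA : forall h : coord_ring,
    tassoc (tmap comul id (comul h)) = tmap id comul (comul h);
  comul_unitl : forall h : coord_ring, tunitl (tmap counit id (comul h)) = h;
  comul_unitr : forall h : coord_ring, tunitr (tmap id counit (comul h)) = h;
  antipodel : forall h : coord_ring,
    tmult (tmap antipode id (comul h)) = (counit h : k)%:A;
  antipoder : forall h : coord_ring,
    tmult (tmap id antipode (comul h)) = (counit h : k)%:A
}.

Definition gs_order (k : fieldType) (g : finGroupScheme k) : nat :=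
  \dim {:coord_ring g}.

(* The field K seen as a k-algebra through iota : k -> K; K may have infinite  *)
(* degree over k, so fieldExtType does not apply.                              *)
Definition over (k K : fieldType) (iota : {rmorphism k -> K}) : Type := K.

Section Over.
Variables (k K : fieldType) (iota : {rmorphism k -> K}).

HB.instance Definition _ := GRing.Field.on (over iota).

Definition over_scale (c : k) (x : over iota) : over iota := iota c * (x : K).

Let over_scaleA c d x : over_scale c (over_scale d x) = over_scale (c * d) x.
Proof. by rewrite /over_scale rmorphM mulrA. Qed.

Let over_scale1 : left_id 1 over_scale.
Proof. by move=> x; rewrite /over_scale rmorph1 mul1r. Qed.

Let over_scaleDr : right_distributive over_scale +%R.
Proof. by move=> c x y; apply: mulrDr. Qed.

Let over_scaleDl x : {morph over_scale^~ x : c d / c + d}.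
Proof. by move=> c d; rewrite /over_scale rmorphD; apply: mulrDl. Qed.

HB.instance Definition _ := GRing.Zmodule_isLmodule.Build k (over iota)
  over_scaleA over_scale1 over_scaleDr over_scaleDl.

Let over_scaleAl (c : k) (x y : over iota) : c *: (x * y) = (c *: x) * y.
Proof. exact: mulrA. Qed.

HB.instance Definition _ := GRing.Lmodule_isLalgebra.Build k (over iota)
  over_scaleAl.

Let over_scaleAr (c : k) (x y : over iota) : c *: (x * y) = x * (c *: y).
Proof. exact: mulrCA. Qed.

HB.instance Definition _ := GRing.Lalgebra_isAlgebra.Build k (over iota)
  over_scaleAr.

End Over.

Record gField (k : fieldType) (g : finGroupScheme k) := GField {
  gf_sort :> fieldType;
  gf_emb : {rmorphism k -> gf_sort};
  coaction : {lrmorphism over gf_emb -> tensor (over gf_emb) g};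
  coaction_unit : forall x : over gf_emb,
    tunitr (tmap id (counit g) (coaction x)) = x;
  coactionA : forall x : over gf_emb,
    tmap id (comul g) (coaction x) = tassoc (tmap coaction id (coaction x))
}.

Section Constants.
Variables (k : fieldType) (g : finGroupScheme k) (K : gField g).

Definition is_constant : {pred K} :=
  fun x => coaction K x == (x : over (gf_emb K)) \ox (1 : g).

Let constP (x : K) :
  reflect (coaction K x = (x : over (gf_emb K)) \ox (1 : g)) (x \in is_constant).
Proof. exact: eqP. Qed.

Lemma is_constant_divring : divring_closed is_constant.
Proof.
split=> [|x y /constP cx /constP cy|x y /constP cx /constP cy]; apply/constP.
- exact: rmorph1.
- transitivity (coaction K x - coaction K y); first exact: rmorphB.
  rewrite cx cy.
  have := tens_linearl (1 : g) (-1) (y : over (gf_emb K)) x.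
  by rewrite !scaleN1r addrC => <-; rewrite addrC.
have [->|y0] := eqVneq y 0.
  rewrite invr0 mulr0 [LHS](rmorph0 (coaction K)); apply: esym.
  by have := tensZl 0 (0 : over (gf_emb K)) (1 : g); rewrite !scale0r.
pose y' : over (gf_emb K) := y^-1.
have yy' : (y : over (gf_emb K)) * y' = 1 by apply: divff.
have -> : x / y = (x : over (gf_emb K)) * y' by [].
transitivity (coaction K x * coaction K y'); first exact: rmorphM.
rewrite cx -[X in _ = _ \ox X](mulr1 (1 : g)) -tensM; congr (_ * _).
rewrite -[LHS]mulr1 -tens11 -yy' -[X in _ \ox X](mulr1 (1 : g)) -tensM -cy mulrA.
by rewrite -rmorphM mulrC yy' rmorph1 mul1r.
Qed.

HB.instance Definition _ := GRing.isDivringClosed.Build K is_constant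
  is_constant_divring.

Definition constants : Type := {x : K | x \in is_constant}.

HB.instance Definition _ := SubChoice.on constants.
HB.instance Definition _ := [SubChoice_isSubIntegralDomain of constants by <:].
HB.instance Definition _ := [SubIntegralDomain_isSubField of constants by <:].

Definition constants_emb : {rmorphism constants -> K} := val.

End Constants.

(* [L : F] = n, for L an extension of F through iota. *)
Definition has_degree (F L : fieldType) (iota : {rmorphism F -> L}) (n : nat) :
    Prop :=
  exists b : 'I_n -> L, forall x : L,
    exists! c : 'rV[F]_n, x = \sum_i iota (c 0 i) * b i.

(* Main.v *)
(* Write ∂x = Σ_i D_i(x) ⊗ e_i and view it as the row vector (D_i(x))_i over K. *)
(* K-linear relations Σ_j c_j ∂(a_j) = 0 are stable under the D_s: applying     *)
(* ∂ ⊗ id and coassociativity gives                                             *)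
(*   Σ_j (∂(c_j) ⊗ 1) (id ⊗ μ)(∂(a_j)) = 0                                      *)
(* in K ⊗ H ⊗ H, and the H-linear map x ⊗ y ↦ x S(y_1) ⊗ y_2, which sends μ(h)  *)
(* to 1 ⊗ h, turns this into Σ_j D_s(c_j) ∂(a_j) = 0 for all s.                 *)
(* Choose b_1, ..., b_n in K such that the ∂(b_j) form a basis of the K-span of *)
(* ∂(K) in K ⊗ H, so that n <= e. If ∂(x) = Σ_j c_j ∂(b_j), the stability and   *)
(* the uniqueness of the coefficients give D_s(c_j) = D_s(1) c_j, i.e. the c_j  *)
(* are constants, and applying the counit yields x = Σ_j c_j b_j.               *)
From HB Require Import structures.
Require Import Defs.
From mathcomp Require Import all_boot all_order all_algebra all_field.
From Stdlib Require Import Classical.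

Set Implicit Arguments.
Unset Strict Implicit.
Unset Printing Implicit Defensive.

Import GRing.Theory.
Local Open Scope ring_scope.

(** [coaction_row] places every element of K in the K-space of row vectors of length e. When a row
    is expressed through independent rows [coaction_row (b j)], its coefficients are forced to be
    constants, so a K-basis of the span of all rows, chosen among the rows themselves, comes from a
    basis of K over its constants. The crux is [coact_relation], where the antipode enters through
    [antipode_twist_comul]; [coaction_row_coef] deduces constancy, [exists_coaction_basis] supplies
    the b_j, and [coaction_row_constantM] makes the coefficients unique. *)

Section TensorLift.
Variable k : fieldType.

(** * Computing maps out of tensor products *)

Definition bilinear_map (V W U : lmodType k) (f : V -> W -> U) :=
  (forall w, linear (f^~ w)) /\ (forall v, linear (f v)).

Lemma linear_tlift_param (V U T : lmodType k) (W : vectType k)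
    (F : T -> V -> W -> U) (t : tensor V W) :
  (forall v w, linear (fun x => F x v w)) -> linear (fun x => tlift (F x) t).
Proof.
move=> FL c x y; rewrite /tlift scaler_sumr -big_split /=.
by apply: eq_bigr => i _; apply: FL.
Qed.

Lemma tlift_sum (V U : lmodType k) (W : vectType k) (f : V -> W -> U)
    (I : finType) (t : I -> tensor V W) :
  bilinear_map f -> tlift f (\sum_i t i) = \sum_i tlift f (t i).
Proof.
move=> [fl _].
pose g : {linear tensor V W -> U} :=
  HB.pack (tlift f) (GRing.isLinear.Build k _ _ _ (tlift f) (linear_tlift fl)).
exact: (linear_sum g).
Qed.

Lemma tlift_tmap (V V' U : lmodType k) (W W' : vectType k) (f : V' -> W' -> U)
    (a : V -> V') (b : W -> W') (t : tensor V W) :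
  bilinear_map f ->
  tlift f (tmap a b t) = tlift (fun v w => f (a v) (b w)) t.
Proof.
move=> fB; rewrite tlift_sum //; apply: eq_bigr => i _.
exact: (tlift_tens fB.1 fB.2).
Qed.

Lemma tlift_tassoc (V U : lmodType k) (W X : vectType k)
    (F : V -> W -> X -> U) (t : tensor (tensor V W) X) :
    (forall w x, linear (fun v => F v w x)) ->
    (forall v, bilinear_map (F v)) ->
  tlift (fun v s => tlift (F v) s) (tassoc t) =
  tlift (fun s x => tlift (fun v w => F v w x) s) t.
Proof.
move=> F1 F2.
have FB : bilinear_map (fun v (s : tensor W X) => tlift (F v) s).
  split=> [s|v]; first exact: linear_tlift_param.
  exact: (linear_tlift (F2 v).1).
rewrite tlift_sum //; apply: eq_bigr => i _.
rewrite tlift_sum //; apply: eq_bigr => j _.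
by rewrite (tlift_tens FB.1 FB.2) (tlift_tens (F2 _).1 (F2 _).2).
Qed.

Lemma tlift_tmul (A : algType k) (B : falgType k) (U : lmodType k)
    (f : A -> B -> U) (t u : tensor A B) :
  bilinear_map f ->
  tlift f (t * u) =
  tlift (fun a x => tlift (fun b y => f (a * b) (x * y)) u) t.
Proof.
move=> fB; rewrite [t * u]/(tmul t u) tlift_sum //; apply: eq_bigr => i _.
rewrite tlift_sum //; apply: eq_bigr => j _.
exact: (tlift_tens fB.1 fB.2).
Qed.

End TensorLift.

(** * Undoing the comultiplication with the antipode *)

Section HopfTwist.
Variables (k : fieldType) (H : finGroupScheme k).

(** Coassociativity tested against a trilinear map, so that no element of a triple tensor product
    has to be handled. *)
Lemma comul_coassoc (U : lmodType k) (F : H -> H -> H -> U) (h : H) :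
    (forall w x, linear (fun v => F v w x)) ->
    (forall v, bilinear_map (F v)) ->
  tlift (fun v y => tlift (F v) (comul H y)) (comul H h) =
  tlift (fun y x => tlift (fun v w => F v w x) (comul H y)) (comul H h).
Proof.
move=> F1 F2.
have FB : bilinear_map (fun v (s : tensor H H) => tlift (F v) s).
  split=> [s|v]; first exact: linear_tlift_param.
  exact: (linear_tlift (F2 v).1).
have FB' : bilinear_map
    (fun (s : tensor H H) x => tlift (fun v w => F v w x) s).
  split=> [x|s]; first by apply: linear_tlift => w; apply: F1.
  by apply: linear_tlift_param => v w; apply: (F2 v).2.
have := congr1 (tlift (fun v s => tlift (F v) s)) (comulA h).
by rewrite tlift_tassoc // !tlift_tmap.
Qed.

Variables p q : {scalar H}.

(* (p ⊗ q) composed with x ⊗ y ↦ x S(y_1) ⊗ y_2 *)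
Definition antipode_twist (x y : H) : k^o :=
  tlift (fun u v => p (x * antipode H u) * q v : k^o) (comul H y).

Lemma bilinear_antipode_twist : bilinear_map antipode_twist.
Proof.
split=> [y|x].
  apply: linear_tlift_param => u v c a b /=.
  by rewrite mulrDl -scalerAl linearP mulrDl -mulrA.
move=> c a b; rewrite /antipode_twist linearP.
apply: linear_tlift => v d u w /=.
by rewrite linearP mulrDr -scalerAr linearP mulrDl -mulrA.
Qed.

(** In Sweedler notation, p(x h_1 S(h_2)) q(h_3) = p(x) q(h): coassociativity groups the first two
    legs, the antipode axiom turns h_1 S(h_2) into a counit, and the counit axiom absorbs it. *)
Lemma antipode_twist_comul (x h : H) :
  tlift (fun a y => antipode_twist (x * a) y) (comul H h) = p x * q h.
Proof.
rewrite /antipode_twist.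
rewrite (comul_coassoc (F := fun a u v => p (x * a * antipode H u) * q v : k^o)).
- have qS a b : q (a *: b) = a * q b by rewrite linearZ.
  rewrite -[in RHS](comul_unitl h) [tunitl _]tlift_tmap; last first.
    split=> [w c a b|v c a b] /=; first by rewrite scalerDl scalerA.
    by rewrite scalerDr !scalerA mulrC.
  rewrite /tlift linear_sum mulr_sumr; apply: eq_bigr => i _ /=.
  rewrite qS mulrA -mulr_suml; congr (_ * _).
  transitivity (p (x * tmult (tmap id (antipode H) (comul H
    (tcoord (comul H h) i))))); last first.
    by rewrite antipoder -scalerAr mulr1 linearZ mulrC.
  rewrite [tmult _]tlift_tmap; last first.
    split=> [w c a b|v c a b] /=; first by rewrite mulrDl scalerAl.
    by rewrite mulrDr scalerAr.
  rewrite /tlift mulr_sumr linear_sum.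
  by apply: eq_bigr => j _; rewrite mulrA.
- move=> w y c a b /=.
  by rewrite mulrDr -scalerAr mulrDl -scalerAl linearP mulrDl -mulrA.
- move=> v; split=> [w c a b|w c a b] /=.
    by rewrite linearP mulrDr -scalerAr linearP mulrDl -mulrA.
  by rewrite linearP mulrDr mulrCA.
Qed.

End HopfTwist.

(** * Contractions of the coaction and stability of relations *)

Section Coaction.
Variables (k : fieldType) (H : finGroupScheme k) (K : gField H).
Local Notation A := (Defs.over (gf_emb K)).
Local Notation "'∂'" := (coaction K).

(** The contraction (id ⊗ φ)∂. Coordinate forms give the D_i and the counit gives the identity;
    general φ are needed for the twisted forms in [coact_relation]. *)
Definition coact (phi : H -> k) (x : A) : A :=
  tlift (fun v h => phi h *: v) (∂ x).

Lemma bilinear_scale_form (phi : {scalar H}) :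
  bilinear_map (fun (v : A) h => phi h *: v).
Proof.
split=> [w c a b|v c a b] /=.
  by rewrite scalerDr !scalerA mulrC.
by rewrite linearP scalerDl scalerA.
Qed.

Lemma coact_coord i (x : A) : coact (coord (vbasis {:H}) i) x = tcoord (∂ x) i.
Proof.
rewrite /coact /tlift (bigD1 i) //= coord_tbasis eqxx scale1r big1 ?addr0 //.
by move=> j /negPf ji; rewrite coord_tbasis ji scale0r.
Qed.

Lemma coactM (phi : {scalar H}) (x y : A) :
  coact phi (x * y) =
  tlift (fun v h => tlift (fun w g => phi (h * g) *: (v * w)) (∂ y)) (∂ x).
Proof. by rewrite /coact rmorphM tlift_tmul //; apply: bilinear_scale_form. Qed.

Lemma coact_sum (phi : {scalar H}) (I : finType) (x : I -> A) :
  coact phi (\sum_i x i) = \sum_i coact phi (x i).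
Proof.
by rewrite /coact linear_sum tlift_sum //; apply: bilinear_scale_form.
Qed.

Lemma coaction_coassoc (U : lmodType k) (F : A -> H -> H -> U) (x : A) :
    (forall w y, linear (fun v => F v w y)) ->
    (forall v, bilinear_map (F v)) ->
  tlift (fun v h => tlift (F v) (comul H h)) (∂ x) =
  tlift (fun y h => tlift (fun v w => F v w h) (∂ y)) (∂ x).
Proof.
move=> F1 F2.
have FB : bilinear_map (fun v (s : tensor H H) => tlift (F v) s).
  split=> [s|v]; first exact: linear_tlift_param.
  exact: (linear_tlift (F2 v).1).
have FB' : bilinear_map
    (fun (s : tensor A H) x => tlift (fun v w => F v w x) s).
  split=> [y|s]; first by apply: linear_tlift => w; apply: F1.
  by apply: linear_tlift_param => v w; apply: (F2 v).2.
have := congr1 (tlift (fun v s => tlift (F v) s)) (coactionA x).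
by rewrite tlift_tassoc // !tlift_tmap.
Qed.

Lemma coact_relation (p q : {scalar H}) (I : finType) (c a : I -> A) :
    (forall i, \sum_j c j * tcoord (∂ (a j)) i = 0) ->
  \sum_j coact p (c j) * coact q (a j) = 0.
Proof.
move=> rel.
pose w := antipode_twist p q; have wB := bilinear_antipode_twist p q.
pose phi h : {scalar H} :=
  HB.pack (w^~ h) (GRing.isLinear.Build k H k *%R (w^~ h) (wB.1 h)).
(* The i-th relation is contracted with w(·, e_i); the sum over i is the twist applied to ∂ ⊗ id of
   the whole relation. *)
have : \sum_i coact (phi (tbasis i)) (\sum_j c j * tcoord (∂ (a j)) i) = 0.
  apply: big1 => i _; rewrite rel /coact linear0.
  by apply: big1 => j _; rewrite [tcoord _ _]ffunE scaler0.
under eq_bigr do rewrite coact_sum.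
rewrite exchange_big => rel'; rewrite -[RHS]rel'; apply: eq_bigr => j _.
under [RHS]eq_bigr => i _ do rewrite (coactM (phi (tbasis i))).
rewrite [RHS]exchange_big mulr_suml; apply: eq_bigr => l _.
set v := tcoord _ l; set h := tbasis l.
pose F (y : A) g g' : A := w (h * g) g' *: (v * y).
(* Coassociativity trades ∂ on the first leg of ∂(a_j) for μ on the second, where the twist
   collapses. *)
transitivity (tlift (fun y g => tlift (F y) (comul H g)) (∂ (a j))); last first.
  apply: coaction_coassoc => [g g' e y1 y2|y] /=.
    by rewrite /F mulrDr -scalerAr scalerDr !scalerA mulrC.
  split=> [g e g1 g2|g e g1 g2] /=.
    by rewrite /F /w mulrDr -scalerAr (wB.1 g) scalerDl scalerA.
  by rewrite /F /w (wB.2 _) scalerDl scalerA.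
rewrite mulr_sumr; apply: eq_bigr => i _.
rewrite /F /tlift -scaler_suml.
have := antipode_twist_comul p q h (tbasis i); rewrite /tlift => ->.
by rewrite -scalerAl -scalerAr scalerA.
Qed.

(** * Rows over K and constancy of coefficients *)

Definition coaction_row (x : A) : 'rV[A]_(\dim {:H}) :=
  \row_i tcoord (∂ x) i.

Lemma coact_counit (x : A) : coact (counit H) x = x.
Proof.
rewrite -[RHS]coaction_unit [RHS]tlift_tmap //.
split=> [w c a b|v c a b] /=; first by rewrite scalerDr !scalerA mulrC.
by rewrite scalerDl scalerA.
Qed.

Lemma constantP (x : A) :
  reflect (forall i, tcoord (∂ x) i = coord (vbasis {:H}) i 1 *: x)
    (x \in is_constant (K := K)).
Proof.
apply: (iffP eqP) => [xc i|xc]; first by rewrite xc tcoordE.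
by apply: tensorP => i; rewrite xc tcoordE.
Qed.

Lemma coaction_row_constantM (c x : A) : c \in is_constant (K := K) ->
  coaction_row (c * x) = c *: coaction_row x.
Proof.
move=> /eqP cc; apply/rowP=> i; rewrite !mxE.
have -> : ∂ (c * x) = (c \ox 1) * ∂ x by rewrite -cc; apply: rmorphM.
rewrite [in LHS](tensor_sum (∂ x)) mulr_sumr tcoord_sum.
rewrite (bigD1 i) //= tensM mul1r tcoordE coord_tbasis eqxx scale1r.
rewrite big1 ?addr0 // => j /negPf ji.
by rewrite tensM mul1r tcoordE coord_tbasis ji scale0r.
Qed.

Lemma coaction_row_sum (I : finType) (x : I -> A) :
  coaction_row (\sum_j x j) = \sum_j coaction_row (x j).
Proof.
apply/rowP=> i; rewrite mxE linear_sum tcoord_sum summxE.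
by apply: eq_bigr => j _; rewrite mxE.
Qed.

Lemma coaction_row_coef (n : nat) (b : 'I_n -> A) (c : 'rV[A]_n) (x : A) :
    row_free (\matrix_j coaction_row (b j)) ->
    coaction_row x = c *m \matrix_j coaction_row (b j) ->
  (forall j, c 0 j \in is_constant (K := K)) /\ x = \sum_j c 0 j * b j.
Proof.
set M := \matrix_j _ => freeM xE.
(* The expression of x becomes a relation: [None] carries x with coefficient 1, [Some j] carries b_j
   with coefficient -c_j. *)
pose c' (j : option 'I_n) : A := if j is Some i then - c 0 i else 1.
pose a (j : option 'I_n) : A := if j is Some i then b i else x.
have split_option (F : option 'I_n -> A) :
    \sum_j F j = F None + \sum_i F (Some i).
  rewrite (bigD1 None) //=; congr (_ + _).
  rewrite (reindex_omap Some id) => [|[]//] /=.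
  by apply: eq_bigl => i; rewrite eqxx.
have rel i : \sum_j c' j * tcoord (∂ (a j)) i = 0.
  have := congr1 (fun r : 'rV_ _ => r 0 i) xE; rewrite !mxE => xi.
  rewrite split_option /= mul1r xi -big_split /=; apply: big1 => j _.
  by rewrite !mxE mulNr subrr.
have coactN (p : {scalar H}) (y : A) : coact p (- y) = - coact p y.
  rewrite /coact /tlift -sumrN; apply: eq_bigr => i _.
  by rewrite -scalerN -[in LHS](scaleN1r y) linearZ tcoordZ scaleN1r.
have coact1 s : coact (coord (vbasis {:H}) s) 1 =
    coord (vbasis {:H}) s 1 *: (1 : A).
  by rewrite coact_coord rmorph1 -tens11 tcoordE.
(* Both sides have the same product with the row-free matrix, namely D_s(1) times the row of x. *)
have stable s : \row_j coact (coord (vbasis {:H}) s) (c 0 j) =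
    coord (vbasis {:H}) s 1 *: (1 : A) *: c.
  apply: (row_free_inj freeM); rewrite -scalemxAl -xE; apply/rowP => t.
  have := coact_relation (coord (vbasis {:H}) s) (coord (vbasis {:H}) t) rel.
  rewrite split_option /= coact1 coact_coord.
  under eq_bigr do rewrite coactN mulNr.
  rewrite sumrN => /eqP; rewrite subr_eq0 => /eqP e.
  rewrite !mxE e; apply: eq_bigr => j _.
  by rewrite !mxE !coact_coord.
split=> [j|].
  apply/constantP => s; have := congr1 (fun r : 'rV_ _ => r 0 j) (stable s).
  by rewrite !mxE coact_coord -scalerAl mul1r.
rewrite -[LHS]coact_counit /coact /tlift.
have xi i : tcoord (∂ x) i = \sum_j c 0 j * tcoord (∂ (b j)) i.
  have := congr1 (fun r : 'rV_ _ => r 0 i) xE; rewrite !mxE => ->.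
  by apply: eq_bigr => j _; rewrite !mxE.
under eq_bigr do rewrite xi scaler_sumr.
rewrite exchange_big /=; apply: eq_bigr => j _.
rewrite -[in RHS](coact_counit (b j)) /coact /tlift mulr_sumr.
by apply: eq_bigr => i _; rewrite scalerAr.
Qed.

(** Greedy extension of an independent family; [d] bounds the number of extensions left, since the
    rank cannot exceed dim H. Excluded middle decides whether some row lies outside the current
    span. *)
Lemma exists_coaction_basis : exists (n : nat) (b : 'I_n -> A),
  row_free (\matrix_j coaction_row (b j)) /\
  forall x, (coaction_row x <= \matrix_j coaction_row (b j))%MS.
Proof.
suff ext d n (b : 'I_n -> A) : (\dim {:H} <= n + d)%N ->
    row_free (\matrix_j coaction_row (b j)) ->
    exists (n : nat) (b : 'I_n -> A),
      row_free (\matrix_j coaction_row (b j)) /\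
      forall x, (coaction_row x <= \matrix_j coaction_row (b j))%MS.
  apply: (ext (\dim {:H}) 0 (fun=> 0)) => //.
  by rewrite /row_free; have := rank_leq_row
    (\matrix_(j < 0) coaction_row ((fun=> 0) j)); rewrite leqn0.
elim: d n b => [|d IHd] n b len free.
  exists n, b; split=> // x; apply: submx_full.
  rewrite /row_full eqn_leq rank_leq_col (eqP free).
  by rewrite addn0 in len.
have [[x xN]|full] := classic (exists x,
    ~~ (coaction_row x <= \matrix_j coaction_row (b j))%MS); last first.
  exists n, b; split=> // x; apply/negPn/negP => xN; apply: full.
  by exists x.
pose b' (j : 'I_(1 + n)) : A := if split j is inr i then b i else x.
apply: (IHd _ b'); first by rewrite add1n addSnnS.
have -> : \matrix_j coaction_row (b' j) =
    col_mx (coaction_row x) (\matrix_j coaction_row (b j)).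
  apply/row_matrixP => j; rewrite rowK /b' -(splitK j).
  case: (split j) => i; rewrite unsplitK /=.
    by rewrite rowKu row_id.
  by rewrite rowKd rowK.
rewrite /row_free eqn_leq rank_leq_row /=.
apply: (@leq_ltn_trans (\rank (\matrix_j coaction_row (b j)))).
  by rewrite (eqP free).
apply: rank_ltmx; rewrite ltmxE col_mx_sub (negPf xN) /= andbT.
by rewrite -addsmxE addsmxSr.
Qed.

End Coaction.

Theorem theorem4p4 (k : fieldType) (g : finGroupScheme k) (K : gField g) :
  exists n : nat, has_degree (constants_emb K) n /\ (n <= gs_order g)%N.
Proof.
have [n [b [free full]]] := exists_coaction_basis K.
exists n; split; last first.
  by rewrite -(eqP free); apply: rank_leq_col.
exists b => x.
have /submxP [c xE] := full x.
have [cc xs] := coaction_row_coef free xE.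
exists (\row_j (Sub (c 0 j) (cc j) : constants K)); split.
  by rewrite xs; apply: eq_bigr => j _; rewrite mxE.
move=> d xd.
(* Uniqueness: constants pass through the coaction, so any other coefficients also express the row
   of x in the independent rows. *)
pose d' : 'rV[Defs.over (gf_emb K)]_n := \row_j val (d 0 j).
have d'E : coaction_row x = d' *m \matrix_j coaction_row (b j).
  rewrite xd (coaction_row_sum (K := K)) mulmx_sum_row.
  apply: eq_bigr => j _; rewrite rowK mxE.
  exact/coaction_row_constantM/(valP (d 0 j)).
have cd : c = d' by apply: (row_free_inj free); rewrite -xE.
by apply/rowP => j; apply: val_inj; rewrite mxE SubK cd mxE.
Qed.
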